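(* Let $d\ge2$ and $n\ge 2$. Any orthogonal array $OA_\lambda(n,N)$ ($\lambda\ge1$) over an alphabet of size $d^2$ can be used to invert the time evolution of a quantum network of $n$ nodes of dimension $d$ with $N-1$ local operations and time overhead $N-1$. That is, if such an orthogonal array exists, then there are local unitaries $U_1,\dots,U_{N-1}$ on $(\mathbb{C}^d)^{\otimes n}$ such that for every pair-interaction Hamiltonian $H$ on $(\mathbb{C}^d)^{\otimes n}$ $$-H=\sum_{j=1}^{N-1}U_j^\dagger HU_j .$$
   Context: Let $\{\sigma_\alpha\mid\alpha=1,\dots,d^2-1\}$ be an orthogonal basis (trace inner product) of the real vector space of traceless Hermitian operators on $\mathbb{C}^d$, and let $\sigma^k_\alpha$ be the operator on $(\mathbb{C}^d)^{\otimes n}$ acting as $\sigma_\alpha$ on the $k$-th tensor factor (node) and as the identity elsewhere. A pair-interaction Hamiltonian is an operator $H=\sum_{k\ne l}\sum_{\alpha,\beta}J_{kl;\alpha\beta}\sigma^k_\alpha\sigma^l_\beta+\sum_{k}\sum_\alpha r_{k;\alpha}\sigma^k_\alpha$ with real coefficients and $J_{kl;\alpha\beta}=J_{lk;\beta\alpha}$. A local unitary is $U=V_1\otimes\cdots\otimes V_n$ with $V_k\in SU(d)$. A representation $\tilde H=\sum_j\tau_jU_j^\dagger HU_j$ with $\tau_j>0$ and local unitaries $U_j$ is a simulation of $\tilde H$ by $H$ with time overhead $\sum_j\tau_j$; inverting $H$ means simulating $-H$ by $H$ (with operations not depending on $H$, which may be unknown). An orthogonal array $OA_\lambda(n,N)$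 (strength 2, index $\lambda$) over a finite alphabet $\mathcal{A}$ is an $n\times N$ array $(m_{kj})$ with entries in $\mathcal{A}$ such that for all $1\le k<l\le n$ each pair in $\mathcal{A}\times\mathcal{A}$ occurs exactly $\lambda$ times in the list $((m_{kj},m_{lj})\mid j=1,\dots,N)$. *)

(* Defs.v *)
From HB Require Import structures.
From mathcomp Require Import all_boot all_order all_algebra.
From mathcomp Require Import sesquilinear spectral.
From mathcomp Require Import complex.
From mathcomp Require Import reals.

Set Implicit Arguments.
Unset Strict Implicit.
Unset Printing Implicit Defensive.

Import Order.TTheory GRing.Theory Num.Theory.

Local Open Scope ring_scope.
Local Open Scope sesquilinear_scope.
Local Open Scope complex_scope.

(* The product basis of (C^d)^{\otimes n} is indexed by the multi-indices
   x : {ffun 'I_n -> 'I_d}, numbered by enum_val since matrix indices are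
   ordinals. *)
Notation multi_index n d := {ffun 'I_n -> 'I_d}.

Definition net_op (R : realType) (n d : nat) : Type := 'M[R[i]]_#|multi_index n d|.

Definition tensor_op (R : realType) (n d : nat) (V : 'I_n -> 'M[R[i]]_d) :
    net_op R n d :=
  \matrix_(x, y) \prod_(k < n)
     V k ((enum_val x : multi_index n d) k) ((enum_val y : multi_index n d) k).

Definition at_node (R : realType) (n d : nat) (k : 'I_n) (A : 'M[R[i]]_d) :
    net_op R n d :=
  tensor_op (fun l => if l == k then A else 1%:M).

Definition special_unitary (R : realType) (d : nat) (V : 'M[R[i]]_d) : Prop :=
  V \is unitarymx /\ \det V = 1.

Definition local_unitary (R : realType) (n d : nat) (U : net_op R n d) : Prop :=
  exists V : 'I_n -> 'M[R[i]]_d,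
    (forall k, special_unitary (V k)) /\ U = tensor_op V.

Definition traceless_hermitian (R : realType) (d : nat) (A : 'M[R[i]]_d) : Prop :=
  A \is hermsymmx /\ \tr A = 0.

Definition orthogonal_hermitian_basis (R : realType) (d : nat)
    (sigma : 'I_(d ^ 2 - 1) -> 'M[R[i]]_d) : Prop :=
  [/\ forall a, traceless_hermitian (sigma a),
      forall a b, a != b -> \tr ((sigma a)^t* *m sigma b) = 0
    & forall A, traceless_hermitian A ->
        exists! c : {ffun 'I_(d ^ 2 - 1) -> R},
          A = \sum_a (c a)%:C *: sigma a].

Definition pair_hamiltonian (R : realType) (n d : nat)
    (sigma : 'I_(d ^ 2 - 1) -> 'M[R[i]]_d) (H : net_op R n d) : Prop :=
  exists (J : 'I_n -> 'I_n -> 'I_(d ^ 2 - 1) -> 'I_(d ^ 2 - 1) -> R)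
         (r : 'I_n -> 'I_(d ^ 2 - 1) -> R),
    (forall k l a b, k != l -> J k l a b = J l k b a) /\
    H = \sum_k \sum_(l | k != l) \sum_a \sum_b
          (J k l a b)%:C *: (at_node k (sigma a) *m at_node l (sigma b))
      + \sum_k \sum_a (r k a)%:C *: at_node k (sigma a).

Definition orthogonal_array (A : finType) (n N lambda : nat) (m : 'M[A]_(n, N)) :
    Prop :=
  forall k l : 'I_n, (k < l)%N -> forall a b : A,
    #|[set j : 'I_N | (m k j == a) && (m l j == b)]| = lambda.

(* Main.v *)
(** The [d ^ 2] Weyl-Heisenberg unitaries [V_a], rescaled to determinant 1,
    satisfy [sum_a V_a^* A V_a = d tr(A) 1], so this sum vanishes on traceless
    [A]. Let [T_j] act on node [k] as [V_(m k j)]. Since any two rows of the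
    array contain every pair of symbols equally often, conjugating a pair term
    by the [T_j] and summing over [j] gives a multiple of the product of two
    vanishing sums; local terms vanish likewise. Hence
    [sum_j T_j^* H T_j = 0]. Conjugating by [T_0^*] turns the term [j = 0]
    into [H], and [U_j := T_j T_0^*] for [j <> 0] inverts [H]. *)

Require Import Defs.
From mathcomp Require Import all_boot all_order all_algebra.
From mathcomp Require Import sesquilinear spectral complex reals.
From mathcomp Require Import cyclic separable cyclotomic.

Import GRing.Theory Num.Theory.

Set Implicit Arguments.
Unset Strict Implicit.

Local Open Scope ring_scope.
Local Open Scope sesquilinear_scope.
Local Open Scope complex_scope.

(** * Weyl-Heisenberg unitaries of determinant 1 *)

Section UnitaryErrorBasis.
Variable C : numClosedFieldType.

Lemma trmxCK (m n : nat) (A : 'M[C]_(m, n)) : A^t*^t* = A.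
Proof. by apply/matrixP => i j; rewrite !mxE conjCK. Qed.

Lemma trmxC_mul (m n p : nat) (A : 'M[C]_(m, n)) (B : 'M[C]_(n, p)) :
  (A *m B)^t* = B^t* *m A^t*.
Proof. by rewrite trmx_mul map_mxM. Qed.

(** In characteristic 0, ['X^n - 1] is separable and splits, so it has [n] distinct roots; [n]
    distinct [n]-th roots of unity include a primitive one. *)
Lemma prim_root_exists (n : nat) :
  (0 < n)%N -> exists z : C, n.-primitive_root z.
Proof.
move=> n_gt0; pose p : {poly C} := 'X^n - 1.
have [r Dp] := closed_field_poly_normal p.
rewrite (monicP _) ?monicXnsubC // scale1r in Dp.
have rn1 : all n.-unity_root r by apply/allP => z; rewrite -root_prod_XsubC -Dp.
have sz_r : (n < (size r).+1)%N.
  by rewrite -(size_prod_XsubC r id) -Dp size_XnsubC.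
have [|z] := hasP (has_prim_root n_gt0 rn1 _ sz_r); last by exists z.
by rewrite -separable_prod_XsubC -Dp separable_Xn_sub_1 // pnatr_eq0 -lt0n.
Qed.

Lemma norm1_mulCK (z : C) : `|z| = 1 -> z^* * z = 1.
Proof. by move=> z1; rewrite -normCKC z1 expr1n. Qed.

Lemma norm_prim_root (n : nat) (z : C) : n.-primitive_root z -> `|z| = 1.
Proof.
move=> z_prim; apply/eqP.
rewrite -(@pexpr_eq1 _ _ n) ?(prim_order_gt0 z_prim) //.
by rewrite -normrX (prim_expr_order z_prim) normr1.
Qed.

(** A geometric sum whose ratio [u] satisfies [u ^+ n = 1]: it vanishes unless [u = 1], which forces
    [z ^+ i = z ^+ j], hence [i = j]. *)
Lemma sum_prim_root_orthogonal (n : nat) (z : C) (i j : 'I_n) :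
  n.-primitive_root z ->
  \sum_(b < n) (z ^+ (b * i))^* * z ^+ (b * j) = n%:R *+ (i == j).
Proof.
move=> z_prim; have z1 := norm_prim_root z_prim.
pose u : C := (z ^+ i)^* * z ^+ j.
have zi1 : `|z ^+ i| = 1 by rewrite normrX z1 expr1n.
have -> : \sum_(b < n) (z ^+ (b * i))^* * z ^+ (b * j) = \sum_(b < n) u ^+ b.
  apply: eq_bigr => b _; rewrite exprMn -rmorphXn /= -!exprM.
  by rewrite (mulnC i) (mulnC j).
have [ij | ij] := eqVneq i j.
  have -> : u = 1 by rewrite /u -ij norm1_mulCK.
  by under eq_bigr do rewrite expr1n; rewrite sumr_const card_ord.
apply/eqP; have /eqP := subrX1 u n.
have -> : u ^+ n = 1.
  rewrite exprMn -rmorphXn /= -!exprM mulnC (mulnC j) !exprM.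
  by rewrite (prim_expr_order z_prim) !expr1n rmorph1 mulr1.
rewrite subrr eq_sym mulf_eq0 mulr0n => /orP[|//]; rewrite subr_eq0 => /eqP u1.
suff /eqP : z ^+ i = z ^+ j.
  rewrite (eq_prim_root_expr z_prim) !modn_small //.
  by move=> /eqP/val_inj eq_ij; rewrite eq_ij eqxx in ij.
have : z ^+ i * u = z ^+ i by rewrite u1 mulr1.
by rewrite mulrA [z ^+ i * _]mulrC norm1_mulCK // mul1r.
Qed.

(* The generalized Pauli (Weyl-Heisenberg) operators: clock powers times cyclic
   shifts. Summing over clocks kills the off-diagonal entries of [A], summing
   over shifts averages its diagonal. *)
Lemma unitary_error_basis (d : nat) : (0 < d)%N ->
  exists V : 'I_d * 'I_d -> 'M[C]_d,
    (forall s, V s \is unitarymx) /\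
    (forall A, \sum_s (V s)^t* *m A *m V s = (d%:R * \tr A)%:M).
Proof.
case: d => // p _; have [z z_prim] := prim_root_exists (ltn0Sn p).
(* [s.1] is the shift and [s.2] the clock exponent; indices add modulo [p.+1]. *)
pose V (s : 'I_p.+1 * 'I_p.+1) : 'M[C]_p.+1 :=
  \matrix_(i, j) (z ^+ (s.2 * i) *+ (i == j + s.1)).
have VE s A i j : ((V s)^t* *m A *m V s) i j =
    (z ^+ (s.2 * (i + s.1)%R))^* * A (i + s.1) (j + s.1)
      * z ^+ (s.2 * (j + s.1)%R).
  rewrite mxE (bigD1 (j + s.1)) //= big1 ?addr0 => [|k /negPf nk]; last first.
    by rewrite [V s _ _]mxE nk mulr0.
  rewrite [V s _ _]mxE eqxx; congr (_ * _).
  rewrite mxE (bigD1 (i + s.1)) //= big1 ?addr0 => [|k /negPf nk]; last first.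
    by rewrite !mxE nk rmorph0 mul0r.
  by rewrite !mxE eqxx.
exists V; split=> [s | A].
  rewrite -trmxC_unitary; apply/unitarymxP; rewrite trmxCK.
  (* Unitarity is the entry formula [VE] at the identity matrix. *)
  rewrite -[(V s)^t*]mulmx1; apply/matrixP => i j; rewrite VE !mxE.
  rewrite (inj_eq (addIr _)); have [->|_] := eqVneq i j; last first.
    by rewrite mulr0 mul0r.
  by rewrite mulr1 norm1_mulCK // normrX (norm_prim_root z_prim) expr1n.
apply/matrixP => i j; rewrite summxE -(pair_bigA _ (fun a b =>
  ((V (a, b))^t* *m A *m V (a, b)) i j)) /=.
(* For each fixed shift [a], the sum over clock exponents is evaluated by root-of-unity
   orthogonality at [i + a] and [j + a]. *)
transitivity (\sum_a A (i + a) (j + a) * (p.+1%:R *+ (i == j))).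
  apply: eq_bigr => a _.
  rewrite -(inj_eq (addIr a)) -(sum_prim_root_orthogonal _ _ z_prim).
  rewrite mulr_sumr; apply: eq_bigr => b _.
  by rewrite VE /= mulrCA mulrA.
rewrite mxE; have [<-|_] := eqVneq i j; last first.
  by rewrite mulr0n big1 // => a _; rewrite mulr0.
rewrite !mulr1n -mulr_suml mulrC; congr (_ * _).
by rewrite /mxtrace [RHS](reindex_inj (addrI i)).
Qed.

(** Since [\det (c *: V) = c ^+ d * \det V] and [\det V] has modulus 1, a [d]-th root of its
    conjugate serves as [c]. *)
Lemma special_phase (d : nat) (V : 'M[C]_d) : (0 < d)%N -> V \is unitarymx ->
  exists2 c : C, c^* * c = 1 & \det (c *: V) = 1.
Proof.
move=> d_gt0 /unitarymxP/(congr1 determinant).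
rewrite det_mulmx det_map_mx det_tr det1 => detV1.
have det_norm : `|\det V| = 1.
  by apply/eqP; rewrite -(@pexpr_eq1 _ _ 2) // normCK detV1.
exists (d.-root (\det V)^*).
  by rewrite norm1_mulCK // norm_rootC norm_conjC det_norm rootC1.
by rewrite detZ rootCK // mulrC.
Qed.

(** Rescaling by phases fixes the determinants and cancels in every conjugation. *)
Lemma special_unitary_error_basis (d : nat) : (0 < d)%N ->
  exists V : 'I_d * 'I_d -> 'M[C]_d,
    (forall s, V s \is unitarymx /\ \det (V s) = 1) /\
    (forall A, \sum_s (V s)^t* *m A *m V s = (d%:R * \tr A)%:M).
Proof.
move=> d_gt0; have [V [V_unitary V_sum]] := @unitary_error_basis d d_gt0.
have /fin_all_exists2[c c1 c_det] s := special_phase d_gt0 (V_unitary s).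
have adjZ s : (c s *: V s)^t* = (c s)^* *: (V s)^t*.
  by apply/matrixP => i j; rewrite !mxE rmorphM.
exists (fun s => c s *: V s); split=> [s|A].
  split=> //; apply/unitarymxP.
  rewrite adjZ -scalemxAl -scalemxAr scalerA (unitarymxP (V_unitary s)).
  by rewrite mulrC c1 scale1r.
rewrite -V_sum; apply: eq_bigr => s _.
by rewrite adjZ -!scalemxAl -scalemxAr scalerA c1 scale1r.
Qed.

Lemma unitary_conj_comp (n : nat) (S T A : 'M[C]_n) :
  (T *m S^t*)^t* *m A *m (T *m S^t*) = S *m (T^t* *m A *m T) *m S^t*.
Proof. by rewrite trmxC_mul trmxCK !mulmxA. Qed.

Lemma unitary_conjK (n : nat) (S A : 'M[C]_n) : S \is unitarymx ->
  S *m (S^t* *m A *m S) *m S^t* = A.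
Proof.
move=> /unitarymxP S_unitary.
by rewrite -unitary_conj_comp S_unitary trmx1 map_mx1 mul1mx mulmx1.
Qed.

Lemma unitary_conj_mul (n : nat) (T A B : 'M[C]_n) : T \is unitarymx ->
  T^t* *m (A *m B) *m T = (T^t* *m A *m T) *m (T^t* *m B *m T).
Proof. by move=> T_unitary; rewrite !mulmxA (mulmxtVK _ T_unitary). Qed.

End UnitaryErrorBasis.

(** * Tensor products and operators acting at one node *)

Section Network.
Variables (R : realType) (n d : nat).
Implicit Types (V W : 'I_n -> 'M[R[i]]_d) (A B : 'M[R[i]]_d) (k l : 'I_n).

Lemma eq_tensor_op V W : V =1 W -> tensor_op V = tensor_op W.
Proof.
move=> VW; apply/matrixP => x y; rewrite !mxE.
by apply: eq_bigr => k _; rewrite VW.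
Qed.

Lemma tensor_op_mul V W :
  tensor_op V *m tensor_op W = tensor_op (fun k => V k *m W k).
Proof.
apply/matrixP => x y; rewrite !mxE.
under [RHS]eq_bigr do rewrite mxE.
(* Distributivity: a product over nodes of sums over local indices is one sum over multi-indices. *)
rewrite bigA_distr_bigA /= [RHS](reindex_onto enum_val enum_rank) /=; last first.
  by move=> f _; rewrite enum_rankK.
apply: eq_big => [z|z _]; first by rewrite enum_valK eqxx.
by rewrite !mxE -big_split.
Qed.

Lemma tensor_op_trmxC V : (tensor_op V)^t* = tensor_op (fun k => (V k)^t*).
Proof.
apply/matrixP => x y; rewrite !mxE rmorph_prod.
by apply: eq_bigr => k _; rewrite !mxE.
Qed.

Lemma tensor_op1 : tensor_op (fun=> 1%:M) = 1%:M :> net_op R n d.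
Proof.
apply/matrixP => x y; rewrite !mxE; under eq_bigr do rewrite mxE.
have [->|xy] := eqVneq x y; first by rewrite big1 // => k _; rewrite eqxx.
have [k xyk] : exists k, enum_val x k != enum_val y k.
  apply/existsP; apply: contraR xy => /existsPn eq_xy.
  apply/eqP/enum_val_inj/ffunP => k; apply/eqP.
  by rewrite -[_ == _]negbK; apply: eq_xy.
by rewrite (bigD1 k) //= (negPf xyk) mul0r.
Qed.

Lemma at_node0 k : at_node k (0 : 'M[R[i]]_d) = 0.
Proof.
by apply/matrixP => x y; rewrite !mxE (bigD1 k) //= eqxx mxE mul0r.
Qed.

Lemma at_nodeD k A B : at_node k (A + B) = at_node k A + at_node k B.
Proof.
apply/matrixP => x y; rewrite !mxE.
rewrite (bigD1 k) //= [X in _ = X + _](bigD1 k) //=.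
rewrite [X in _ = _ + X](bigD1 k) //=.
rewrite !eqxx mxE mulrDl.
by congr (_ * _ + _ * _); apply: eq_bigr => l /negPf ->.
Qed.

Lemma at_node_sum (I : finType) k (F : I -> 'M[R[i]]_d) :
  at_node k (\sum_s F s) = \sum_s at_node k (F s).
Proof. exact: (big_morph _ (at_nodeD k) (at_node0 k)). Qed.

Lemma tensor_op_unitary V :
  (forall k, V k \is unitarymx) -> tensor_op V \is unitarymx.
Proof.
move=> V_unitary; apply/unitarymxP; rewrite tensor_op_trmxC tensor_op_mul -tensor_op1.
by apply: eq_tensor_op => k; apply/unitarymxP.
Qed.

(** At each node other than [k] the factors collapse to [(V l)^t* *m V l = 1]. *)
Lemma at_node_conj V k A : (forall k, V k \is unitarymx) ->
  (tensor_op V)^t* *m at_node k A *m tensor_op V =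
  at_node k ((V k)^t* *m A *m V k).
Proof.
move=> V_unitary; rewrite tensor_op_trmxC !tensor_op_mul.
apply: eq_tensor_op => l; case: eqVneq => [->//|_].
by rewrite mulmx1; apply/mulmx1C/unitarymxP.
Qed.

Lemma at_node2_conj V k l A B : (forall k, V k \is unitarymx) ->
  (tensor_op V)^t* *m (at_node k A *m at_node l B) *m tensor_op V =
  at_node k ((V k)^t* *m A *m V k) *m at_node l ((V l)^t* *m B *m V l).
Proof.
move=> V_unitary; rewrite (unitary_conj_mul _ _ (tensor_op_unitary V_unitary)).
by rewrite (at_node_conj k A V_unitary) (at_node_conj l B V_unitary).
Qed.

End Network.

(** * Counting in orthogonal arrays *)

Section OrthogonalArray.
Variables (A : finType) (n N lambda : nat) (m : 'M[A]_(n, N)).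
Hypothesis m_oa : orthogonal_array lambda m.

Lemma orthogonal_array_neq (k l : 'I_n) (a b : A) : k != l ->
  #|[set j | (m k j == a) && (m l j == b)]| = lambda.
Proof.
rewrite neq_ltn => /orP[kl | lk]; first exact: m_oa.
by rewrite -(m_oa lk b a); apply: eq_card => j; rewrite !inE andbC.
Qed.

(** Columns are grouped by the pair of symbols in rows [k] and [l]; every class has [lambda]
    members. *)
Lemma orthogonal_array_sum (M : nmodType) (k l : 'I_n) (F : A -> A -> M) :
  k != l ->
  \sum_j F (m k j) (m l j) = (\sum_a \sum_b F a b) *+ lambda.
Proof.
move=> kl; rewrite pair_bigA /= -sumrMnl.
rewrite (partition_big (fun j => (m k j, m l j)) xpredT) //=.
apply: eq_bigr => -[a b] _; rewrite -(orthogonal_array_neq a b kl) -sumr_const.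
by apply: eq_big => [j|j /eqP[-> ->]//]; rewrite inE xpair_eqE.
Qed.

(** Some column must carry the pair [(a, a)] in the first two rows. *)
Lemma orthogonal_array_gt0 : (2 <= n)%N -> (0 < #|A|)%N -> (0 < lambda)%N ->
  (0 < N)%N.
Proof.
move=> n2 /card_gt0P[a _]; have n0 := ltnW n2.
rewrite -(@orthogonal_array_neq (Ordinal n0) (Ordinal n2) a a) //.
by move=> /leq_trans; apply; rewrite -[N in (_ <= N)%N]card_ord max_card.
Qed.

End OrthogonalArray.

(** * The inversion scheme *)

Unset Implicit Arguments.

Theorem theorem4 (R : realType) (d n : nat) (hd : (2 <= d)%N) (hn : (2 <= n)%N)
    (sigma : 'I_(d ^ 2 - 1) -> 'M[R[i]]_d)
    (hsigma : orthogonal_hermitian_basis sigma)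
    (A : finType) (hA : #|A| = (d ^ 2)%N)
    (N lambda : nat) (hlambda : (1 <= lambda)%N)
    (m : 'M[A]_(n, N)) (hm : orthogonal_array lambda m) :
  exists U : 'I_(N - 1) -> net_op R n d,
    (forall j, local_unitary (U j)) /\
    (forall H : net_op R n d, pair_hamiltonian sigma H ->
       - H = \sum_(j < N - 1) ((U j)^t* *m H *m U j)).
Proof.
have d_gt0 : (0 < d)%N := ltnW hd.
have N_gt0 : (0 < N)%N.
  by apply: (orthogonal_array_gt0 hm) => //; rewrite hA expn_gt0 d_gt0.
(* From here the array has [N.+1] columns: column [ord0] is the reference, the other [N] give the
   operations. *)
case: N N_gt0 m hm => // N _ m hm; rewrite subn1 /=.
have [W [W_su W_sum]] := special_unitary_error_basis (R[i]) d_gt0.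
have card_idx : #|A| = #|{: 'I_d * 'I_d}|.
  by rewrite hA card_prod card_ord mulnn.
pose idx a := enum_val (cast_ord card_idx (enum_rank a)).
have idx_bij : bijective idx.
  exists (fun s => enum_val (cast_ord (esym card_idx) (enum_rank s))) => s.
    by rewrite enum_valK cast_ordK enum_rankK.
  by rewrite /idx enum_valK cast_ordKV enum_rankK.
pose V a := W (idx a).
have V_unitary a : V a \is unitarymx by have [] := W_su (idx a).
have V_sum k a : \sum_b at_node k ((V b)^t* *m sigma a *m V b) = 0.
  rewrite -at_node_sum.
  have [/(_ a)[_ tr0] _ _] := hsigma.
  have -> : \sum_b (V b)^t* *m sigma a *m V b =
      \sum_s (W s)^t* *m sigma a *m W s.
    by rewrite [RHS](reindex idx) //; apply: onW_bij.
  by rewrite W_sum tr0 mulr0 raddf0 at_node0.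
pose T j := tensor_op (fun k => V (m k j)).
have T_unitary j : T j \is unitarymx by apply: tensor_op_unitary.
have T_sum H : pair_hamiltonian sigma H ->
    \sum_j (T j)^t* *m H *m T j = 0.
  (* This property is closed under linear combinations, so only pair terms and local terms need
     checking. *)
  pose vanishes H := \sum_j (T j)^t* *m H *m T j = 0.
  have vanishes0 : vanishes 0 by apply: big1 => j _; rewrite mulmx0 mul0mx.
  have vanishesD X Y : vanishes X -> vanishes Y -> vanishes (X + Y).
    move=> X0 Y0; rewrite /vanishes.
    under eq_bigr do rewrite mulmxDr mulmxDl.
    by rewrite big_split /= X0 Y0 addr0.
  have vanishesZ c X : vanishes X -> vanishes (c *: X).
    move=> X0; rewrite /vanishes.
    under eq_bigr do rewrite -scalemxAr -scalemxAl.
    by rewrite -scaler_sumr X0 scaler0.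
  have vanishes_sum (I : finType) (P : pred I) F :
      (forall s, P s -> vanishes (F s)) -> vanishes (\sum_(s | P s) F s).
    exact: (big_ind vanishes vanishes0 vanishesD).
  move=> [J [r [_ ->]]]; apply: vanishesD.
    apply: (vanishes_sum) => k _; apply: (vanishes_sum) => l kl.
    apply: (vanishes_sum) => a _; apply: (vanishes_sum) => b _.
    apply: vanishesZ; rewrite /vanishes.
    under eq_bigr do rewrite at_node2_conj //.
    rewrite (orthogonal_array_sum hm (fun x y =>
      at_node k ((V x)^t* *m sigma a *m V x)
        *m at_node l ((V y)^t* *m sigma b *m V y)) kl).
    (* For each fixed symbol [x] at node [k], the sum over symbols at node [l] already vanishes by
       [V_sum]. *)
    rewrite big1 ?mul0rn // => x _.
    by rewrite -mulmx_sumr V_sum mulmx0.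
  apply: (vanishes_sum) => k _; apply: (vanishes_sum) => a _.
  apply: vanishesZ; rewrite /vanishes.
  under eq_bigr do rewrite at_node_conj //.
  (* The array only counts pairs, so an auxiliary second row [l] is paired with row [k]; the summand
     ignores its symbol. *)
  have [l lk] : exists l : 'I_n, l != k.
    have [->|k0] := eqVneq k (Ordinal (ltnW hn)); last first.
      by exists (Ordinal (ltnW hn)); rewrite eq_sym.
    by exists (Ordinal hn).
  rewrite (orthogonal_array_sum hm (fun _ x =>
    at_node k ((V x)^t* *m sigma a *m V x)) lk).
  by rewrite big1 ?mul0rn // => x _; rewrite V_sum.
exists (fun j => T (lift ord0 j) *m (T ord0)^t*); split=> [j | H /T_sum].
  exists (fun k => V (m k (lift ord0 j)) *m (V (m k ord0))^t*); split.
    move=> k; split; first by rewrite mul_unitarymx ?trmxC_unitary.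
    (* Determinant 1 of both factors keeps the product special unitary. *)
    have detV a : \det (V a) = 1 by have [] := W_su (idx a).
    by rewrite det_mulmx det_map_mx det_tr !detV rmorph1 mulr1.
  by rewrite tensor_op_trmxC tensor_op_mul.
(* Isolating column [ord0]: the other terms add up to [- ((T ord0)^t* *m H *m T ord0)], and undoing
   the conjugation by [T ord0] leaves [- H]. *)
rewrite big_ord_recl => /eqP; rewrite addrC addr_eq0 => /eqP sumE.
under eq_bigr do rewrite unitary_conj_comp.
rewrite -mulmx_suml -mulmx_sumr sumE mulmxN mulNmx.
by rewrite unitary_conjK.
Qed.
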